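(* Let $p$ be a complex polynomial of one variable of degree $n$. Assume that $A$ is a closable operator in a Hilbert (or Banach) space $H$ such that ($p(A)$ is densely defined and) $\sigma[p(A)]\neq\mathbb{C}$. Then $A$ is closed.
   Context: Spaces are complex. Operators are linear and not necessarily bounded, with domain $D(A)$ a linear subspace of $H$. Products are defined on natural domains, $D(ST)=\{x\in D(T):Tx\in D(S)\}$, and sums on $D(S+T)=D(S)\cap D(T)$; $p(A)$ has domain $D(A^n)$, where $n=\deg p$. An operator is closed if its graph is closed, and closable if it has a closed extension. For any (not necessarily closed) operator $S$, the resolvent set $\rho(S)$ is the set of $\lambda\in\mathbb{C}$ such that $\lambda I-S:D(S)\to H$ is bijective with $(\lambda I-S)^{-1}\in B(H)$ (bounded and everywhere defined), and $\sigma(S)=\mathbb{C}\setminus\rho(S)$. In particular $\sigma(S)=\mathbb{C}$ if $S$ is not closed, so the closedness of $p(A)$ is tacitly assumed.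
   Formalization: The degree n of p is assumed to be at least 1; for a constant p the claim fails, since p(A) = cI has spectrum {c} for any closable, non-closed A. *)

(* Defs.v *)
From mathcomp Require Export all_boot all_order all_algebra.
From mathcomp Require Export all_classical all_reals all_analysis.
From mathcomp Require Export complex.

Set Implicit Arguments.
Unset Strict Implicit.
Unset Printing Implicit Defensive.

Import Order.TTheory GRing.Theory Num.Theory.
Export numFieldNormedType.Exports.

Local Open Scope classical_set_scope.
Local Open Scope ring_scope.

(* A linear operator in V, not necessarily everywhere defined. The values of
   [opfun] outside [dom] are junk: no definition below depends on them. *)
Record operator (K : fieldType) (V : lmodType K) := Operator {
  dom : set V;
  opfun :> V -> V;
  dom_submod : GRing.submod_closed [in dom];
  op_linear : forall (a : K) (x y : V), dom x -> dom y ->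
    opfun (a *: x + y) = a *: opfun x + opfun y
}.

Section Algebra.
Context {K : fieldType} {V : lmodType K}.
Implicit Types S T A : operator V.

Lemma op_dom0 S : dom S 0.
Proof. by have [+ _] := dom_submod S; rewrite inE. Qed.

Lemma op_domP S (a : K) (x y : V) : dom S x -> dom S y -> dom S (a *: x + y).
Proof.
by move=> Sx Sy; have [_ /(_ a x y)] := dom_submod S; rewrite !inE; apply.
Qed.

Lemma op0 S : S 0 = 0.
Proof.
have := op_linear 1 (op_dom0 S) (op_dom0 S).
by rewrite !scale1r addr0 => /eqP; rewrite -subr_eq subrr => /eqP.
Qed.

Lemma submod_closedI (D : set V) : D 0 ->
  (forall (a : K) (x y : V), D x -> D y -> D (a *: x + y)) ->
  GRing.submod_closed [in D].
Proof.
by move=> D0 DP; split=> [|a x y]; rewrite !inE //; apply: DP.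
Qed.

Fact op_id_submod : GRing.submod_closed [in [set: V]].
Proof. exact: submod_closedI. Qed.

Definition op_id : operator V :=
  Operator op_id_submod (opfun := id) (fun _ _ _ _ _ => erefl).

Fact op_mul_submod S T :
  GRing.submod_closed [in [set x | dom T x /\ dom S (T x)]].
Proof.
apply: submod_closedI => [|a x y [Tx STx] [Ty STy]] /=.
  by split; rewrite ?op0; apply: op_dom0.
by split; rewrite ?op_linear //; apply: op_domP.
Qed.

Fact op_mul_linear S T (a : K) (x y : V) :
  dom T x /\ dom S (T x) -> dom T y /\ dom S (T y) ->
  S (T (a *: x + y)) = a *: S (T x) + S (T y).
Proof. by move=> [Tx STx] [Ty STy]; rewrite !op_linear. Qed.

Definition op_mul S T : operator V :=
  Operator (op_mul_submod S T) (opfun := fun x => S (T x)) (@op_mul_linear S T).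

Fixpoint op_exp A (n : nat) : operator V :=
  if n is m.+1 then op_mul A (op_exp A m) else op_id.

Lemma dom_op_exp A (m n : nat) : (m <= n)%N -> dom (op_exp A n) `<=` dom (op_exp A m).
Proof.
elim: n => [|n IHn]; first by rewrite leqn0 => /eqP ->.
rewrite leq_eqVlt => /predU1P[-> //|/IHn sub x [] /sub //].
Qed.

Fact op_poly_linear (p : {poly K}) A (a : K) (x y : V) :
  dom (op_exp A (size p).-1) x -> dom (op_exp A (size p).-1) y ->
  \sum_(i < size p) p`_i *: op_exp A i (a *: x + y) =
  a *: (\sum_(i < size p) p`_i *: op_exp A i x) +
    \sum_(i < size p) p`_i *: op_exp A i y.
Proof.
move=> Ax Ay; rewrite scaler_sumr -big_split /=.
apply: eq_bigr => i _; have le_i : (i <= (size p).-1)%N.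
  by rewrite -ltnS prednK // (leq_ltn_trans _ (ltn_ord i)).
have sub := dom_op_exp (A := A) le_i.
by rewrite (op_linear _ (sub _ Ax) (sub _ Ay)) scalerDr !scalerA mulrC.
Qed.

(* The domain is that of A^n with n = deg p = (size p).-1. *)
Definition op_poly (p : {poly K}) A : operator V :=
  Operator (dom_submod (op_exp A (size p).-1))
    (opfun := fun x => \sum_(i < size p) p`_i *: op_exp A i x)
    (@op_poly_linear p A).

End Algebra.

Section Topology.
Context {K : numFieldType} {V : normedModType K}.
Implicit Types S T : operator V.

Definition graph S : set (V * V) := [set xy | dom S xy.1 /\ xy.2 = S xy.1].

Definition closed_op S : Prop := closed (graph S).

Definition closable_op S : Prop :=
  exists T : operator V, closed_op T /\ graph S `<=` graph T.

Definition bounded_op (B : V -> V) : Prop :=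
  exists M : K, forall x : V, `|B x| <= M * `|x|.

(* Since l - S is a bijection from dom S onto V, the map B is its inverse. *)
Definition resolvent_set S : set K :=
  [set l | set_bij (dom S) [set: V] (fun x : V => l *: x - S x) /\
    exists B : {linear V -> V}, bounded_op B /\
      forall x : V, dom S x -> B (l *: x - S x) = x].

Definition spectrum S : set K := ~` resolvent_set S.

End Topology.

(* Main.v *)
(* Let [l] be in the resolvent set of [p(A)] and [B = (l - p(A))^-1], a bounded
   operator with range [D(A^n)]. It commutes with [A] on [D(A)]: if [y] is in
   [D(A)], comparing leading terms in [l B y - p(A) B y = y] shows that [B y] is
   in [D(A^(n+1))], so [A] commutes with [l - p(A)] at [B y].
   If [(x, y)] is in the closure of the graph of [A], then [(B x, B y)] is in the
   closure of the graph as well, and [B x] is in [D(A)], so [A B x = B y] by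
   closability. Hence [A B x] is in [D(A^n)], [B x] is in [D(A^(n+1))], and
   applying [l - p(A)] gives that [x] is in [D(A)] with [A x = y]. *)
Require Import Defs.
Import Order.TTheory GRing.Theory Num.Theory.
Local Open Scope classical_set_scope.
Local Open Scope ring_scope.
Local Open Scope complex_scope.

Section Algebra.
Context {K : fieldType} {V : lmodType K}.
Implicit Types (S A : operator V) (p : {poly K}).

Lemma op_domZ S (a : K) (x : V) : dom S x -> dom S (a *: x).
Proof. by move=> Sx; rewrite -[_ *: _]addr0; apply: op_domP (op_dom0 _). Qed.

Lemma op_domB S (x y : V) : dom S x -> dom S y -> dom S (x - y).
Proof. by move=> Sx Sy; rewrite -scaleN1r addrC; apply: op_domP. Qed.

Lemma op_linearZ S (a : K) (x : V) : dom S x -> S (a *: x) = a *: S x.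
Proof.
by move=> Sx; rewrite -[_ *: x]addr0 op_linear ?op0 ?addr0 //; apply: op_dom0.
Qed.

Lemma op_linearB S (x y : V) : dom S x -> dom S y -> S (x - y) = S x - S y.
Proof.
by move=> Sx Sy; rewrite -scaleN1r addrC op_linear // scaleN1r addrC.
Qed.

Lemma op_sum S (I : Type) (r : seq I) (P : pred I) (a : I -> K) (F : I -> V) :
  (forall i, P i -> dom S (F i)) ->
  dom S (\sum_(i <- r | P i) a i *: F i) /\
  S (\sum_(i <- r | P i) a i *: F i) = \sum_(i <- r | P i) a i *: S (F i).
Proof.
move=> SF; apply: (big_rec2 (fun u v => dom S u /\ S u = v)).
  by rewrite op0; split=> //; apply: op_dom0.
move=> i u v Pi [Sv <-]; have Si := SF i Pi.
by split; [apply: op_domP | rewrite op_linear].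
Qed.

Lemma op_expSr A (n : nat) (x : V) : op_exp A n (A x) = A (op_exp A n x).
Proof. by elim: n => //= n ->. Qed.

(** [op_exp] applies each new factor [A] last; this form applies it first, as needed once [A (B x)]
    is known to be [B y]. *)
Lemma dom_op_expSr A (n : nat) (x : V) :
  dom (op_exp A n.+1) x <-> dom A x /\ dom (op_exp A n) (A x).
Proof.
elim: n => [|n IHn]; first by split=> -[].
rewrite -[dom (op_exp A n.+2) x]/(dom (op_exp A n.+1) x /\ dom A (op_exp A n.+1 x)).
rewrite IHn -[dom (op_exp A n.+1) (A x)]/(dom _ _ /\ dom A (op_exp A n (A x))).
by rewrite op_expSr /=; tauto.
Qed.

(** The extra power puts every [op_exp A i x] of the sum in [dom A], so [A] can be applied term by
    term. *)
Lemma op_poly_comm p A (x : V) : dom (op_exp A (size p).-1.+1) x ->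
  dom A (op_poly p A x) /\ A (op_poly p A x) = op_poly p A (A x).
Proof.
move=> Ax; have Ai (i : 'I_(size p)) : true -> dom A (op_exp A i x).
  have le_i : (i.+1 <= (size p).-1.+1)%N by rewrite (ltn_predK (ltn_ord i)).
  by have [] := dom_op_exp le_i Ax.
have [Dp Ep] := op_sum A _ (index_enum _) _ (fun i : 'I_(size p) => p`_i) _ Ai.
by split=> //=; rewrite Ep; apply: eq_bigr => i _; rewrite op_expSr.
Qed.

(* The leading term of [p(A) x] is the only one that may leave [dom A]. *)
Lemma dom_op_polyS p A (x : V) :
  p != 0 -> dom (op_poly p A) x -> dom A (op_poly p A x) ->
  dom (op_exp A (size p).-1.+1) x.
Proof.
move=> p0 px; have sz_p : size p = (size p).-1.+1.
  by rewrite prednK // size_poly_gt0.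
have Ep : op_poly p A x = \sum_(i < (size p).-1) p`_i *: op_exp A i x +
    lead_coef p *: op_exp A (size p).-1 x.
  rewrite /= -[LHS](big_mkord xpredT (fun i => p`_i *: op_exp A i x)).
  by rewrite {1}sz_p big_mkord big_ord_recr.
rewrite Ep => Apx; split=> //.
have Ai (i : 'I_(size p).-1) : true -> dom A (op_exp A i x).
  by have [] := dom_op_exp (ltn_ord i) px.
have [Dq _] := op_sum A _ (index_enum _) _ (fun i : 'I_(size p).-1 => p`_i) _ Ai.
have /(op_domZ A (lead_coef p)^-1) := op_domB A _ _ Apx Dq.
by rewrite addrAC subrr add0r scalerA mulVf ?lead_coef_eq0 // scale1r.
Qed.

End Algebra.

Lemma bounded_op_continuous {K : numFieldType} {V : normedModType K}
  (B : {linear V -> V}) : bounded_op B -> continuous B.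
Proof.
move=> [M BM]; apply/linear_bounded_continuous/linear_boundedP.
(* [K] is only partially ordered and [M] may fail to be real; [|M|] is a real bound, comparable with
   [r] near infinity. *)
have leM x : `|B x| <= `|M| * `|x|.
  rewrite -[X in _ * X]normr_id -normrM.
  by rewrite (le_trans (BM x)) // real_ler_norm // ger0_real // (le_trans _ (BM x)).
near=> r => x; apply: le_trans (leM x) _.
by apply: ler_wpM2r => //; near: r; apply: nbhs_pinfty_ge; rewrite normr_real.
Unshelve. all: by end_near. Qed.

Theorem theorem3p1 (R : realType) (H : completeNormedModType R[i])
    (p : {poly R[i]}) (n : nat) (A : operator H) :
  (0 < n)%N -> size p = n.+1 ->
  closable_op A ->
  spectrum (op_poly p A) <> [set: R[i]] ->
  closed_op A.
Proof.
move=> n_gt0 sz_p [T [clT sAT]] nspec.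
have [l [[_ _ surj] [B [[M BM] BK]]]] :
    exists l, resolvent_set (op_poly p A) l.
  apply: contrapT => nex; apply: nspec; apply/seteqP; split=> // l _ rl.
  by apply: nex; exists l.
have p0 : p != 0 by rewrite -size_poly_gt0 sz_p.
have subp x : dom (op_poly p A) x -> dom A x.
  (* Positive degree matters here: for a constant [p] the domain would be all of [H]. *)
  move=> px; have le1 : (1 <= (size p).-1)%N by rewrite sz_p.
  by have [] := dom_op_exp le1 px.
have KB y : dom (op_poly p A) (B y) /\ l *: B y - op_poly p A (B y) = y.
  by have [x px <-] := surj y I; rewrite BK.
have AB y : dom A y -> dom A (B y) /\ B (A y) = A (B y).
  move=> Ay; have [pBy Ey] := KB y; have ABy := subp _ pBy.
  have ApBy : dom A (op_poly p A (B y)).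
    by rewrite -[op_poly p A _](subKr (l *: B y)) Ey; apply/op_domB/Ay/op_domZ.
  have := dom_op_polyS p A _ p0 pBy ApBy => AnBy.
  have [_ Acomm] := op_poly_comm p A _ AnBy.
  have [_ pABy] := (dom_op_expSr A _ (B y)).1 AnBy.
  (* Write [A (B y)] as [B] of [(l - p(A)) A (B y)]; by commutation that argument is
     [A ((l - p(A)) (B y)) = A y]. *)
  split=> //; rewrite -(BK _ pABy) -Acomm; congr (B _).
  by rewrite -op_linearZ // -op_linearB ?Ey //; apply: op_domZ.
have BB_cont : continuous (fun z : H * H => (B z.1, B z.2)).
  have cB := bounded_op_continuous B (ex_intro _ M BM).
  by move=> z; apply: cvg_pair; (apply: continuous_comp; [|exact: cB]);
    [exact: cvg_fst | exact: cvg_snd].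
have closedBB := (continuous_closedP _).1 BB_cont _ clT.
move=> [x y] clA.
(* The preimage of [graph T] under [B] on both coordinates is closed and contains [graph A], hence
   its closure. *)
have [_ /= EBy] : graph T (B x, B y).
  apply: (closedBB (x, y)); apply: closure_subset clA => -[u v] [/= Au ->].
  by have [ABu ->] := AB u Au; apply: sAT.
have [pBx Ex] := KB x; have ABx := subp _ pBx.
have {}EBy : B y = A (B x).
  by rewrite EBy; have [_ /= ->] := sAT (B x, A (B x)) (conj ABx erefl).
have [pBy Ey] := KB y.
have AnBx : dom (op_exp A (size p).-1.+1) (B x).
  by apply/dom_op_expSr; rewrite -EBy.
have [ApBx Acomm] := op_poly_comm p A _ AnBx.
(* Now [x = l *: B x - p(A) (B x)] has both terms in [dom A], and [A] sends it to
   [l *: B y - p(A) (B y) = y]. *)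
split; rewrite /= -Ex; first exact/op_domB/ApBx/op_domZ.
by rewrite op_linearB ?op_linearZ ?Acomm -?EBy ?Ey //; apply: op_domZ.
Qed.
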